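(* For all integers $n\ge 0$ and all integers $k\ge j\ge 0$, \[ a_{9(k-j)+4,\;9k+2}(9n+7)\equiv 0 \pmod 3. \]
   Context: For positive integers $r,s$, $a_{r,s}(n)$ denotes the number of multicolored partitions of $n$ in which each even part may appear in one of $r$ colors and each odd part may appear in one of $s$ colors (copies of the same part size in different colors are distinct), with $a_{r,s}(0)=1$. Equivalently, for $|q|<1$, $\sum_{n\ge0}a_{r,s}(n)q^n = f_2^{s-r}/f_1^{s}$, where $f_m=\prod_{i\ge1}(1-q^{mi})$. *)

(* Defs.v *)
From mathcomp Require Import all_boot.

Set Implicit Arguments.
Unset Strict Implicit.
Unset Printing Implicit Defensive.

Definition ncolors (r s i : nat) : nat := if odd i then s else r.

(* The tag [i : 'I_n] stands for the part size [i.+1], so the sizes are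
   1, ..., n (no larger part can occur in a partition of n). *)
Definition colored_part (r s n : nat) : finType :=
  {i : 'I_n & 'I_(ncolors r s i.+1)}.

Definition part_size (r s n : nat) (p : colored_part r s n) : nat :=
  (tag p).+1.

(* A multicolored partition is the function giving the multiplicity of each
   colored part; no multiplicity can exceed n, hence the codomain ['I_n.+1]. *)
Definition multicolored_partitions (r s n : nat) :
    {set {ffun colored_part r s n -> 'I_n.+1}} :=
  [set m : {ffun colored_part r s n -> 'I_n.+1} |
    \sum_(p : colored_part r s n) m p * part_size p == n].

Definition a (r s n : nat) : nat := #|multicolored_partitions r s n|.

Lemma a0 (r s : nat) : a r s 0 = 1.
Proof.
have E : colored_part r s 0 -> False by case=> -[].
rewrite /a; set A := multicolored_partitions r s 0.
suff -> : A = [set [ffun=> ord0]] by rewrite cards1.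
apply/setP=> m; rewrite !inE big1 => [|p]; last by case: (E p).
by rewrite eqxx; apply/esym/eqP/ffunP=> p; case: (E p).
Qed.

(* Main.v *)
(* Since s - r = 9j - 2, the generating function is f_2^(9j-2) / f_1^(9k+2).
   Write O and V for the products of 1 - q^i over odd and even i, so that
   f_1 = O V and f_2 = V. Modulo 3 the generating function is a ninth power times
   O^7 V^5 = phi^2 (O V)^3, where phi = O^2 V. The triple product gives
   phi = \sum_l (-1)^l q^(l^2) and, for b = \sum_l (-1)^l q^(3 l^2 - 2 l),
   O^2 b = V^3 modulo 3. Splitting the first sum according to l mod 3 yields
   phi = phi^9 + q b^3 over F_3, whence b O V = (phi / O^3)^3 (phi^9 + q b^3).
   Therefore the generating function has the form
   x^3 + q^2 y^3 + 2 (q u^9 + q^4 v^9), and none of these terms contributes to an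
   exponent congruent to 7 mod 9. Power series are taken modulo q^N, that is, in
   F_3[X] / X^N. *)
Require Import Defs.
From mathcomp Require Import all_boot all_algebra zify ring.

Set Implicit Arguments.
Unset Strict Implicit.
Unset Printing Implicit Defensive.

Import GRing.Theory.
Local Open Scope ring_scope.

(** * Gaussian binomial coefficients and the q-binomial theorem *)

Section QBinomial.

Variable R : comNzRingType.
Implicit Types q x y z : R.

(** The q-Pochhammer symbol (q^e; q^d)_n. *)
Definition qprod q d e n : R := \prod_(j < n) (1 - q ^+ (d * j + e)).

(** The Gaussian binomial coefficient, given by the q-Pascal rule to avoid division. *)
Fixpoint qbin q n k : R :=
  match n, k with
  | _, 0 => 1
  | 0, _.+1 => 0
  | n'.+1, k'.+1 => qbin q n' k' + q ^+ k * qbin q n' k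
  end.

Lemma qbinS q n k :
  qbin q n.+1 k.+1 = qbin q n k + q ^+ k.+1 * qbin q n k.+1.
Proof. by []. Qed.

Lemma qbinn0 q n : qbin q n 0 = 1.
Proof. by case: n. Qed.

Lemma qbin_small q n k : (n < k)%N -> qbin q n k = 0.
Proof.
elim: n k => [|n IHn] [|k] //; rewrite ltnS => lt_nk.
by rewrite qbinS !IHn ?mulr0 ?addr0 // ltnW.
Qed.

Lemma qbinomial q y z n :
  \prod_(i < n) (y + z * q ^+ i) =
  \sum_(k < n.+1) qbin q n k * q ^+ 'C(k, 2) * z ^+ k * y ^+ (n - k).
Proof.
elim: n z => [|n IHn] z.
  by rewrite big_ord0 big_ord_recl big_ord0 /= !expr0; ring.
rewrite big_ord_recl expr0 mulr1.
under eq_bigr => i _ do rewrite [q ^+ _]exprS mulrA.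
rewrite IHn mulrDl [RHS]big_ord_recl.
have -> : \sum_(k < n.+1) qbin q n.+1 (lift ord0 k) * q ^+ 'C(lift ord0 k, 2) *
      z ^+ lift ord0 k * y ^+ (n.+1 - lift ord0 k) =
    \sum_(k < n.+1) (qbin q n k * q ^+ 'C(k.+1, 2) * z ^+ k.+1 * y ^+ (n - k)
      + q ^+ k.+1 * qbin q n k.+1 * q ^+ 'C(k.+1, 2) * z ^+ k.+1 * y ^+ (n - k)).
  by apply: eq_bigr => k _; rewrite lift0 qbinS subSS !mulrDl.
rewrite big_split /= [RHS]addrCA [LHS]addrC; congr (_ + _).
  rewrite mulr_sumr; apply: eq_bigr => k _.
  by rewrite binS bin1 exprD exprMn [z ^+ k.+1]exprS; ring.
rewrite big_ord_recl big_ord_recr /= [qbin q n n.+1]qbin_small //.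
rewrite !(mulr0, mul0r) addr0.
rewrite mulrDr !qbinn0 !subn0 !expr0 exprS; congr (_ + _); first by ring.
rewrite mulr_sumr; apply: eq_bigr => k _.
rewrite [bump 0 k]/bump add1n binS bin1 exprD exprMn.
have -> : (n - k)%N = (n - k.+1).+1 by have := ltn_ord k; lia.
by rewrite [y ^+ _.+1]exprS; ring.
Qed.

Lemma qbin_fact q n k : (k <= n)%N ->
  qbin q n k * qprod q 1 1 k * qprod q 1 1 (n - k) = qprod q 1 1 n.
Proof.
have PS m : qprod q 1 1 m.+1 = qprod q 1 1 m * (1 - q ^+ m.+1).
  by rewrite /qprod big_ord_recr /= mul1n addn1.
elim: n k => [|n IHn] [|k] le_kn //.
- by rewrite /qprod big_ord0 !mul1r.
- by rewrite qbinn0 subn0 /qprod big_ord0 !mul1r.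
rewrite qbinS subSS !PS; have E1 := IHn k le_kn.
move: le_kn; rewrite ltnS leq_eqVlt => /predU1P[eq_kn | lt_kn].
  rewrite eq_kn in E1 *; rewrite [qbin q n n.+1]qbin_small //.
  by rewrite -[RHS](congr1 ( *%R^~ _) E1); ring.
have E2 := IHn _ lt_kn; rewrite PS in E2.
have Dn : (n - k)%N = (n - k.+1).+1 by lia.
rewrite Dn PS in E1 *.
have -> : q ^+ n.+1 = q ^+ k.+1 * q ^+ (n - k.+1).+1.
  by rewrite -exprD; congr (_ ^+ _); lia.
(* With Q = q^(k+1) and Q' = q^(n-k), 1 - QQ' = (1 - Q) + Q(1 - Q'). *)
transitivity (qprod q 1 1 n * (1 - q ^+ k.+1) +
  q ^+ k.+1 * qprod q 1 1 n * (1 - q ^+ (n - k.+1).+1)); last by ring.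
by rewrite -{1}E1 -E2; ring.
Qed.

End QBinomial.

(** * Theta sums and a finite Jacobi triple product *)

Section Theta.
Variable R : comNzRingType.
Implicit Types q x y z : R.

(* The sum of (-1)^l q^(a l^2 - c l) over -n <= l <= n; the truncated subtraction
   is exact as soon as c <= a. *)
Definition theta q a c n : R :=
  1 + \sum_(l < n) (-1) ^+ l.+1 *
    (q ^+ (a * l.+1 ^ 2 - c * l.+1) + q ^+ (a * l.+1 ^ 2 + c * l.+1)).

Lemma sum_centered (V : nmodType) (F : nat -> V) n :
  \sum_(k < (n + n).+1) F k =
  F n + \sum_(l < n) (F (n + l.+1)%N + F (n - l.+1)%N).
Proof.
rewrite -addnS big_split_ord /= big_ord_recl addn0 addrCA big_split /=.
congr (_ + _); rewrite addrC; congr (_ + _).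
by rewrite (reindex_inj rev_ord_inj).
Qed.

(** Regularity of [x] allows powers of [x] to be cancelled; the identity is meant for the
    indeterminate and is specialised afterwards. *)
Lemma finite_triple_product x a c n : GRing.lreg x -> (c < a)%N ->
  qprod x (2 * a) (a + c) n * qprod x (2 * a) (a - c) n =
  qbin (x ^+ (2 * a)) (n + n) n + \sum_(l < n) (-1) ^+ l.+1 *
    (qbin (x ^+ (2 * a)) (n + n) (n + l.+1) * x ^+ (a * l.+1 ^ 2 - c * l.+1) +
     qbin (x ^+ (2 * a)) (n + n) (n - l.+1) * x ^+ (a * l.+1 ^ 2 + c * l.+1)).
Proof.
move=> x_reg lt_ca; case: n => [|n'].
  by rewrite /qprod !big_ord0 qbinn0 mulr1 addr0.
set n := n'.+1; set q := x ^+ (2 * a).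
(* This [e] makes the first n factors x^e - x^(2ai) yield the product with a + c and the last n the
   one with a - c; [D] totals the powers of [x] pulled out. *)
pose e := (2 * a * n' + a + c)%N; pose D := (2 * a * 'C(n, 2) + e * n)%N.
have Dbin m : (2 * 'C(m, 2) = m * m.-1)%N.
  elim: m => // m IHm; rewrite binS bin1 mulnDr IHm; case: m {IHm} => //= m.
  nia.
have prod_q m : \prod_(i < m) q ^+ i = q ^+ 'C(m, 2).
  elim: m => [|m IHm]; first by rewrite big_ord0.
  by rewrite big_ord_recr /= IHm -exprD binS bin1.
apply: (lregX (n := D) x_reg); apply: (lregX (n := n) (lregN (@lreg1 R))).
(* The q-binomial theorem at base x^(2a), with exponents shifted by e so that they
   stay nonnegative; the common factor (-1)^n x^D is then cancelled. *)
transitivity (\prod_(i < n + n) (x ^+ e + (-1) * q ^+ i)).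
  rewrite big_split_ord /=.
  have -> : \prod_(i < n) (x ^+ e + -1 * q ^+ i) =
      (-1) ^+ n * q ^+ 'C(n, 2) * qprod x (2 * a) (a + c) n.
    rewrite /qprod [in RHS](reindex_inj rev_ord_inj) -prod_q.
    rewrite -[n in (-1) ^+ n]card_ord -prodr_const -!big_split /=.
    apply: eq_bigr => i _; have := ltn_ord i; rewrite /n => lt_in.
    have -> : e = (2 * a * i + (2 * a * (n'.+1 - i.+1) + (a + c)))%N.
      by rewrite /e subSS -{1}(subnKC (lt_in : i <= n')%N) mulnDr !addnA.
    by rewrite exprD exprM; ring.
  have -> : \prod_(i < n) (x ^+ e + -1 * q ^+ (n + i)) =
      x ^+ (e * n) * qprod x (2 * a) (a - c) n.
    rewrite exprM -[n in (x ^+ e) ^+ n]card_ord -prodr_const -big_split /=.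
    apply: eq_bigr => i _; rewrite -exprM.
    have -> : (2 * a * (n + i) = e + (2 * a * i + (a - c)))%N.
      by rewrite /e /n; nia.
    by rewrite exprD; ring.
  by rewrite /D exprD exprM; ring.
pose F k := qbin q (n + n) k * q ^+ 'C(k, 2) * (-1) ^+ k * (x ^+ e) ^+ (n + n - k).
rewrite qbinomial (sum_centered F) mulrDr mulr_sumr mulrDr mulr_sumr.
have term k t : (a * k * k.-1 + e * (n + n - k) = D + t)%N ->
    F k = (-1) ^+ k * (x ^+ D * (qbin q (n + n) k * x ^+ t)).
  move=> Et; rewrite /F [x ^+ D * _]mulrCA -exprD -Et exprD.
  rewrite /q -!exprM -[(a * k * _)%N]mulnA -Dbin mulnA [(a * 2)%N]mulnC.
  by rewrite [in RHS]mulrA; ring.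
congr (_ + _).
  rewrite (@term n 0%N) ?expr0 ?mulr1 // /D addn0 addnK.
  by rewrite -[(a * n * _)%N]mulnA -Dbin mulnCA mulnA.
apply: eq_bigr => -[l lt_ln] _; rewrite [nat_of_ord _]/=.
have DE : D = (a * (n * n') + e * n)%N by rewrite /D mulnAC Dbin [in RHS]mulnC.
have [r Dn'] : exists r, n' = (l + r)%N by exists (n' - l)%N; lia.
have E1 : F (n + l.+1)%N = (-1) ^+ (n + l.+1) *
    (x ^+ D * (qbin q (n + n) (n + l.+1) * x ^+ (a * l.+1 ^ 2 - c * l.+1))).
  apply: term.
  have -> : (n + n - (n + l.+1) = r)%N by lia.
  have le_c : (c * l.+1 <= a * l.+1 ^ 2)%N by nia.
  apply: (@addIn (c * l.+1)%N); rewrite -[in RHS]addnA subnK //.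
  by rewrite DE /e /n addnS /= Dn'; ring.
have E2 : F (n - l.+1)%N = (-1) ^+ (n + l.+1) *
    (x ^+ D * (qbin q (n + n) (n - l.+1) * x ^+ (a * l.+1 ^ 2 + c * l.+1))).
  rewrite -(@signr_odd R (n + l.+1)) oddD -(oddB lt_ln) signr_odd.
  apply: term.
  have -> : (n + n - (n - l.+1) = n + l.+1)%N by lia.
  have -> : (n - l.+1 = r)%N by lia.
  by rewrite DE /e /n Dn'; case: (r) => [|r'] /=; ring.
by rewrite E1 E2 exprD; ring.
Qed.

End Theta.

(** * Morphisms, products and exponent bounds *)

Lemma rmorph_qprod (R S : comNzRingType) (f : {rmorphism R -> S}) q d e n :
  f (qprod q d e n) = qprod (f q) d e n.
Proof.
rewrite rmorph_prod; apply: eq_bigr => j _.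
by rewrite rmorphB rmorph1 rmorphXn.
Qed.

Lemma rmorph_qbin (R S : comNzRingType) (f : {rmorphism R -> S}) q n k :
  f (qbin q n k) = qbin (f q) n k.
Proof.
elim: n k => [|n IHn] [|k]; rewrite ?qbinn0 ?rmorph1 //; first exact: rmorph0.
by rewrite !qbinS rmorphD rmorphM rmorphXn !IHn.
Qed.

Lemma rmorph_theta (R S : comNzRingType) (f : {rmorphism R -> S}) q a c n :
  f (theta q a c n) = theta (f q) a c n.
Proof.
rewrite rmorphD rmorph1 rmorph_sum; congr (_ + _); apply: eq_bigr => l _.
by rewrite rmorphM rmorphXn rmorphN1 rmorphD !rmorphXn.
Qed.

Lemma qprod_expr (R : comNzRingType) (q : R) k d e n :
  qprod (q ^+ k) d e n = qprod q (k * d) (k * e) n.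
Proof.
by apply: eq_bigr => j _; rewrite -exprM mulnDr mulnA.
Qed.

Lemma qprod_split (R : comNzRingType) (q : R) d e m n :
  qprod q d e (m * n) = \prod_(j < m) qprod q (m * d) (d * j + e) n.
Proof.
elim: n => [|n IHn].
  by rewrite muln0 /qprod big_ord0 big1 // => j _; rewrite big_ord0.
rewrite mulnSr /qprod big_split_ord /= -/(qprod q d e _) IHn.
under [RHS]eq_bigr => j _ do rewrite big_ord_recr.
rewrite big_split /=; congr (_ * _); apply: eq_bigr => j _.
by congr (1 - _ ^+ _); ring.
Qed.

Lemma mul_geometric_sum (R : comNzRingType) (x : R) n :
  (1 - x) * (\sum_(i < n) x ^+ i) = 1 - x ^+ n.
Proof. by rewrite -[RHS]opprB subrX1 -mulNr opprB. Qed.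

Lemma leq_theta_exp a c l : (c < a)%N -> (l <= a * l ^ 2 - c * l)%N.
Proof.
case: l => // l lt_ca; rewrite -mulnn mulnA -mulnBl leq_pmull // subn_gt0.
by rewrite (leq_trans lt_ca) // leq_pmulr.
Qed.

(** * The triple product for nilpotent q *)

Section Truncated.

Variables (R : comUnitRingType) (q : R) (N : nat).
Hypothesis qN : q ^+ N = 0.

Let expr_large m : (N <= m)%N -> q ^+ m = 0.
Proof. by move=> le_Nm; rewrite -(subnKC le_Nm) exprD qN mul0r. Qed.

Lemma qprod_stable d e n :
  (0 < d)%N -> (N <= n)%N -> qprod q d e n = qprod q d e N.
Proof.
move=> d_gt0 le_Nn; rewrite -(subnKC le_Nn) /qprod big_split_ord /=.
rewrite [X in _ * X]big1 ?mulr1 // => j _; rewrite expr_large ?subr0 //; nia.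
Qed.

Lemma qprod_unit d e n : (0 < e)%N -> qprod q d e n \is a GRing.unit.
Proof.
move=> e_gt0; rewrite /qprod unitr_prod // => j _.
apply/unitrPr; exists (\sum_(i < N) (q ^+ (d * j + e)) ^+ i).
by rewrite mul_geometric_sum -exprM expr_large ?subr0 //; nia.
Qed.

Lemma theta_stable a c n :
  (c < a)%N -> (N <= n)%N -> theta q a c n = theta q a c N.
Proof.
move=> lt_ca le_Nn; rewrite -(subnKC le_Nn) /theta big_split_ord /=.
rewrite [X in _ + (_ + X)]big1 ?addr0 // => l _.
have le_exp := leq_theta_exp (N + l).+1 lt_ca.
by rewrite !expr_large ?addr0 ?mulr0 //; lia.
Qed.

(** The finite identity is taken at n = 2N and evaluated at [q]. For l < N the Gaussian binomials
    have both lower indices at least N, so each is the inverse of the stable product; the other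
    terms carry a vanishing power of [q]. *)
Lemma triple_product a c : (c < a)%N ->
  theta q a c N = qprod q (2 * a) (2 * a) N *
    (qprod q (2 * a) (a + c) N * qprod q (2 * a) (a - c) N).
Proof.
move=> lt_ca; have a2_gt0 : (0 < 2 * a)%N by lia.
have le_N : (N <= N + N)%N by lia.
set n := (N + N)%N in le_N.
rewrite -!(@qprod_stable _ _ n) // -(@theta_stable _ _ n) //.
have := congr1 (horner_eval q)
  (finite_triple_product n (monic_lreg (monicX R)) lt_ca).
rewrite rmorphM !rmorph_qprod /= rmorphD rmorph_sum /= rmorph_qbin rmorphXn /=.
have evX : horner_eval q 'X = q by rewrite /horner_eval hornerX.
rewrite evX => ->; rewrite mulrDr /theta.
pose u := qprod q (2 * a) (2 * a) N.
have uU : u \is a GRing.unit by apply: qprod_unit.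
have qbinE k : (N <= k)%N -> (k <= n + n - N)%N ->
    qprod q (2 * a) (2 * a) n * qbin (q ^+ (2 * a)) (n + n) k = 1.
  move=> le_Nk le_kn; have le_k : (k <= n + n)%N by lia.
  have := qbin_fact (q ^+ (2 * a)) le_k.
  rewrite !qprod_expr !muln1 !(@qprod_stable _ _ k) //.
  rewrite (@qprod_stable _ _ (n + n)%N) ?(@qprod_stable _ _ (n + n - k)%N) //;
    try lia.
  rewrite qprod_stable // -/u => E.
  by apply: (mulrI uU); rewrite mulr1 -[RHS]E; ring.
congr (_ + _); first by rewrite qbinE //; lia.
rewrite mulr_sumr; apply: eq_bigr => l _.
rewrite rmorphM rmorphXn rmorphN1 rmorphD !rmorphM !rmorph_qbin !rmorphXn /= evX.
rewrite mulrCA; congr (_ * _); have [le_Nl | lt_lN] := leqP N l.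
  have le_exp := leq_theta_exp l.+1 lt_ca.
  have -> : q ^+ (a * l.+1 ^ 2 - c * l.+1) = 0 by apply: expr_large; lia.
  have -> : q ^+ (a * l.+1 ^ 2 + c * l.+1) = 0 by apply: expr_large; lia.
  by rewrite !mulr0 addr0 mulr0.
by rewrite mulrDr !mulrA !qbinE ?mul1r //; lia.
Qed.

End Truncated.

(** The classes of 1 and -1 mod 3 are exchanged by l -> -l, whence the factor 2. The bound 3n + 1
    makes all three classes complete. *)
Lemma theta_dissection (R : comNzRingType) (q : R) n :
  theta q 1 0 (3 * n).+1 =
  theta (q ^+ 9) 1 0 n - 2 * (q * theta (q ^+ 3) 3 2 n).
Proof.
have thetaS (x : R) a c m : theta x a c m.+1 = theta x a c m +
    (-1) ^+ m.+1 * (x ^+ (a * m.+1 ^ 2 - c * m.+1) +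
                    x ^+ (a * m.+1 ^ 2 + c * m.+1)).
  by rewrite /theta big_ord_recr addrA.
elim: n => [|n IHn].
  by rewrite /theta big_ord_recl !big_ord0 /= muln1 !addr0 !expr1; ring.
have -> : (3 * n.+1).+1 = (3 * n).+1.+3 by lia.
rewrite 3!thetaS IHn !thetaS !mul0n !addn0 !subn0 !mul1n -!exprM.
have -> : ((3 * n).+2 ^ 2 = 1 + 3 * (3 * n.+1 ^ 2 - 2 * n.+1))%N by nia.
have -> : ((3 * n).+3 ^ 2 = 9 * n.+1 ^ 2)%N by nia.
have -> : ((3 * n).+4 ^ 2 = 1 + 3 * (3 * n.+1 ^ 2 + 2 * n.+1))%N by nia.
rewrite !exprD expr1.
have sg m : (-1) ^+ (3 * m) = (-1) ^+ m :> R.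
  by rewrite exprM; congr (_ ^+ _); ring.
by rewrite !exprS sg; ring.
Qed.

(** * Theta identities in characteristic three *)

Section CharacteristicThree.

Variables (R : comUnitRingType) (q : R) (N : nat).
Hypotheses (qN : q ^+ N = 0) (char3 : 3 \in [pchar R]).

Let natr3 : 3 = 0 :> R.
Proof. exact: pcharf0. Qed.

Lemma cubeD (x y : R) : (x + y) ^+ 3 = x ^+ 3 + y ^+ 3.
Proof. exact: (rmorphD (pFrobenius_aut char3)). Qed.

Lemma cube_qprod (x : R) d e n : qprod x d e n ^+ 3 = qprod (x ^+ 3) d e n.
Proof. exact: (rmorph_qprod (pFrobenius_aut char3)). Qed.

Lemma cube_theta (x : R) a c n : theta x a c n ^+ 3 = theta (x ^+ 3) a c n.
Proof. exact: (rmorph_theta (pFrobenius_aut char3)). Qed.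

Let O := qprod q 2 1 N.
Let V := qprod q 2 2 N.
Let phi := theta q 1 0 N.
Let b := theta q 3 2 N.

Lemma theta10E : phi = O ^+ 2 * V.
Proof. by rewrite /phi (triple_product qN) // mulrC addn0 subn0. Qed.

(** After multiplication by [O], Frobenius turns O^3 into (q^3; q^6) and V^3 into (q^6; q^6), while
    [b] supplies the residues 1, 5 and 0 mod 6; the residues 1, 3, 5 reassemble into [O]. *)
Lemma theta32E : O ^+ 2 * b = V ^+ 3.
Proof.
have OU : O \is a GRing.unit by apply: (qprod_unit qN).
apply: (mulrI OU); rewrite mulrA -exprS.
rewrite /O /V cube_qprod cube_qprod !qprod_expr /b (triple_product qN) //.
rewrite -[qprod q 2 1 N](@qprod_stable _ _ _ qN _ _ (3 * N)) //; last by lia.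
rewrite qprod_split !big_ord_recl big_ord0 /= /bump /=.
by ring.
Qed.

Lemma theta10_dissection : phi = phi ^+ 9 + q * b ^+ 3.
Proof.
rewrite {1}/phi -(@theta_stable _ _ _ qN _ _ (3 * N).+1) //; last by lia.
rewrite theta_dissection -[9%N]/(3 * 3)%N !exprM -!cube_theta -/phi -/b.
have -> : 2 = 3 - 1 :> R by ring.
by rewrite natr3; ring.
Qed.

Lemma reciprocal_dissection (A : R) k l :
  A * (O ^+ (9 * k + 2) * V ^+ (9 * l + 4)) = 1 ->
  exists x y u v, A = x ^+ 3 + q ^+ 2 * y ^+ 3 +
    2 * (q * u ^+ 9 + q ^+ 4 * v ^+ 9).
Proof.
move=> A1.
have OU : O \is a GRing.unit by apply: (qprod_unit qN).
(* As [A] equals A^9 times the eighth power of its inverse, the constant exponents are 16 = 9 + 7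
   for [O] and 32 = 27 + 5 for [V]; w^9 absorbs 9 and 27, leaving O^7 V^5. *)
pose w := A * (O ^+ k * V ^+ l) ^+ 8 * (O * V ^+ 3).
have AE : A = w ^+ 9 * (phi ^+ 2 * (O * V) ^+ 3).
  transitivity (A * (A * (O ^+ (9 * k + 2) * V ^+ (9 * l + 4))) ^+ 8).
    by rewrite A1 expr1n mulr1.
  by rewrite theta10E /w !(mulnC 9) !exprD !exprM; ring.
have bOV : b * (O * V) = (phi / O ^+ 3) ^+ 3 * (phi ^+ 9 + q * b ^+ 3).
  rewrite -theta10_dissection; apply: (mulrI (unitrX 9 OU)).
  rewrite exprMn exprVn -exprM.
  have -> : O ^+ 9 * (phi ^+ 3 / O ^+ (3 * 3) * phi) = phi ^+ 4.
    by rewrite mulrA (mulrCA (O ^+ 9)) divrr ?unitrX // mulr1 -exprSr.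
  rewrite theta10E.
  transitivity (O ^+ 8 * V * (O ^+ 2 * b)); first by ring.
  by rewrite theta32E; ring.
(* The squares in (phi^9 + q b^3)^2 give x and y; the cross term contains (b O V)^3, whose two
   summands give u and v. *)
exists (w ^+ 3 * phi ^+ 6 * (O * V)), (w ^+ 3 * b ^+ 2 * (O * V)).
exists (w * phi * (phi / O ^+ 3) * phi ^+ 3), (w * phi * (phi / O ^+ 3) * b).
have bOV3 :
    (b * (O * V)) ^+ 3 = (phi / O ^+ 3) ^+ 9 * (phi ^+ 27 + q ^+ 3 * b ^+ 9).
  by rewrite bOV exprMn cubeD [(q * _) ^+ 3]exprMn -!exprM.
have -> : A = w ^+ 9 * ((phi ^+ 9 + q * b ^+ 3) ^+ 2 * (O * V) ^+ 3).
  by rewrite -theta10_dissection.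
transitivity (w ^+ 9 * (phi ^+ 18 + q ^+ 2 * b ^+ 6) * (O * V) ^+ 3 +
   2 * q * w ^+ 9 * phi ^+ 9 * (b * (O * V)) ^+ 3).
  by ring.
by rewrite bOV3; ring.
Qed.

End CharacteristicThree.

(** * Coefficients and the generating function *)

(** For n a power of p, f -> f^n is additive, so f^n only involves powers of X^n. *)
Lemma coef_expr_pchar (R : comNzRingType) (p n i : nat) (f : {poly R}) :
  p \in [pchar R] -> p.-nat n -> ~~ (n %| i)%N -> (f ^+ n)`_i = 0.
Proof.
move=> pR pn; have n_gt0 : (0 < n)%N by case/andP: pn.
have natn : [pchar {poly R}].-nat n.
  have pRX : p \in [pchar {poly R}] by rewrite pchar_poly.
  by rewrite (eq_pnat _ (pcharf_eq pRX)).
elim/poly_ind: f i => [|f c IHf] i n_i; first by rewrite expr0n gtn_eqF ?coef0.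
rewrite exprDn_pchar // exprMn coefD coefMXn -polyC_exp coefC.
have -> : (i == 0)%N = false by apply: contraNF n_i => /eqP->; rewrite dvdn0.
case: ltnP => [_|le_ni]; rewrite addr0 //; apply: IHf.
by apply: contra n_i => ?; rewrite -(subnK le_ni) dvdn_add.
Qed.

(** Distributing the product over the sums chooses one multiplicity for each colored part. *)
Lemma a_coef (R : comNzRingType) r s n :
  (a r s n)%:R =
  (\prod_(i < n) (\sum_(m < n.+1) 'X^(i.+1) ^+ m) ^+ ncolors r s i.+1)`_n :> R.
Proof.
under eq_bigr => i _ do rewrite -[ncolors r s i.+1]card_ord -prodr_const.
rewrite sig_big_dep /=.
rewrite (bigA_distr_bigA (fun (p : colored_part r s n) (m : 'I_n.+1) =>
  'X^(part_size p) ^+ m : {poly R})) coef_sum.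
rewrite /a -sum1_card natr_sum big_mkcond; apply: eq_bigr => m _.
under eq_bigr => p _ do rewrite -exprM mulnC.
by rewrite -expr_sum coefXn inE eq_sym; case: eqP.
Qed.

Section Truncated.
Variables (R : comUnitRingType) (q : R) (N : nat).
Hypothesis qN : q ^+ N = 0.

Lemma prod_ncolors r s n :
  \prod_(i < 2 * n) (1 - q ^+ i.+1) ^+ ncolors r s i.+1 =
  qprod q 2 1 n ^+ s * qprod q 2 2 n ^+ r.
Proof.
elim: n => [|n IHn]; first by rewrite /qprod !big_ord0 !expr1n mulr1.
rewrite mulnS add2n !big_ord_recr IHn /qprod !big_ord_recr /= !exprMn.
rewrite /ncolors /= mul2n odd_double /= addn1 addn2; ring.
Qed.

Lemma prod_ncolors_trunc r s n : (N <= n.+1)%N ->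
  \prod_(i < n) (1 - q ^+ i.+1) ^+ ncolors r s i.+1 =
  qprod q 2 1 N ^+ s * qprod q 2 2 N ^+ r.
Proof.
move=> le_Nn; have le_n : (n <= 2 * n.+1)%N by lia.
rewrite -!(@qprod_stable _ _ _ qN _ _ n.+1) // -prod_ncolors -(subnKC le_n).
rewrite big_split_ord /= [X in _ * X]big1 ?mulr1 // => i _.
have -> : q ^+ (n + i).+1 = 0.
  by rewrite -addSn -(subnKC (leq_trans le_Nn (leq_addr i n.+1))) exprD qN mul0r.
by rewrite subr0 expr1n.
Qed.

(** Each truncated geometric sum is an exact inverse, since (q^(i+1))^(n+1) = 0. *)
Lemma mul_genfun (F : comNzRingType) (f : {rmorphism {poly F} -> R}) r s n :
  f 'X = q -> N = n.+1 ->
  f (\prod_(i < n) (\sum_(m < n.+1) 'X^(i.+1) ^+ m) ^+ ncolors r s i.+1) *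
  (qprod q 2 1 N ^+ s * qprod q 2 2 N ^+ r) = 1.
Proof.
move=> fX Nn; rewrite -(@prod_ncolors_trunc r s n) ?Nn //.
rewrite rmorph_prod -big_split big1 //= => i _.
rewrite rmorphXn rmorph_sum -exprMn /=.
under eq_bigr => t _ do rewrite !rmorphXn /= fX.
rewrite mulrC mul_geometric_sum -exprM mulnC exprM -Nn qN expr0n subr0.
by rewrite expr1n.
Qed.

End Truncated.

Lemma genfun_dissection (F : comNzRingType) (R : comUnitRingType)
    (f : {rmorphism {poly F} -> R}) (g : R -> {poly F}) k l n :
    cancel g f -> 3 \in [pchar R] -> f 'X ^+ n.+1 = 0 ->
  exists x y u v,
  f (\prod_(i < n) (\sum_(m < n.+1) 'X^(i.+1) ^+ m) ^+
       ncolors (9 * l + 4) (9 * k + 2) i.+1) =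
  f (x ^+ 3 + 'X^2 * y ^+ 3 + 2 * ('X * u ^+ 9 + 'X^4 * v ^+ 9)).
Proof.
move=> gK char3 qN.
have [x [y [u [v ->]]]] := reciprocal_dissection qN char3
  (mul_genfun qN (9 * l + 4) (9 * k + 2) (erefl _) (erefl _)).
exists (g x), (g y), (g u), (g v).
by rewrite !(rmorph_nat, rmorphXn, rmorphD, rmorphM) /= !gK.
Qed.

Lemma coef_dissection (F : comNzRingType) (x y u v : {poly F}) n :
  3 \in [pchar F] ->
  (x ^+ 3 + 'X^2 * y ^+ 3 + 2 * ('X * u ^+ 9 + 'X^4 * v ^+ 9))`_(9 * n + 7) = 0.
Proof.
move=> char3; rewrite mulr_natl coefD coefMn !coefD -['X * _]/('X^1 * _) !coefXnM.
do ![rewrite ifN; last by lia].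
(* The remaining indices are 9n+7 and 9n+5, prime to 3, and 9n+6 and 9n+3, not divisible by 9. *)
by rewrite !(coef_expr_pchar _ char3) ?addr0 ?mul0rn ?addr0 //; lia.
Qed.

(** * The quotient ring F[X]/X^N *)

Section TruncatedPoly.

Variables (F : fieldType) (N : nat).
Hypothesis N_gt0 : (0 < N)%N.
Local Notation Q := {poly %/ ('X^N : {poly F})}.
Local Notation pi := (in_qpoly ('X^N : {poly F})).

Lemma in_qpolyXn_eq0 : pi 'X ^+ N = 0.
Proof.
rewrite -rmorphXn; apply: val_inj => /=.
(* [mk_monic] replaces the constant modulus X^0 by X, hence the exponent [N.-1.+1]. *)
by rewrite mk_monic_Xn prednK // Pdiv.RingMonic.rmodpp ?monicXn.
Qed.

Lemma coef_in_qpolyXn (p : {poly F}) i : (i < N)%N -> (pi p)`_i = p`_i.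
Proof.
move=> lt_iN; rewrite /= mk_monic_Xn prednK //.
rewrite {2}(Pdiv.RingMonic.rdivp_eq (monicXn F N) p) coefD coefMXn lt_iN.
by rewrite add0r.
Qed.

Lemma in_qpolyK : cancel (fun x : Q => x : {poly F}) pi.
Proof. by move=> x; apply/val_inj/in_qpoly_small/size_mk_monic. Qed.

End TruncatedPoly.

Local Close Scope ring_scope.

Theorem theorem1p9 (n j k : nat) (le_jk : j <= k) :
  a (9 * (k - j) + 4) (9 * k + 2) (9 * n + 7) = 0 %[mod 3].
Proof.
set m := 9 * n + 7.
apply/eqP; rewrite mod0n -[_ == 0]/(3 %| _).
have char3 : 3 \in [pchar 'F_3]%R by apply: pchar_Fp.
rewrite (dvdn_pcharf char3) a_coef.
(* Truncation at X^(m+1) still retains the coefficient of X^m. *)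
have charQ : 3 \in [pchar {poly %/ ('X^(m.+1) : {poly 'F_3})}]%R.
  by rewrite pchar_qpoly.
have [x [y [u [v piE]]]] := genfun_dissection k (k - j) (@in_qpolyK _ m.+1)
  charQ (@in_qpolyXn_eq0 _ m.+1 isT).
by rewrite -(@coef_in_qpolyXn _ m.+1) // piE coef_in_qpolyXn // coef_dissection.
Qed.
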